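(* Let $p$ be a prime with $p-1$ divisible by $4$, and let $u_1=\left(\frac{p-1}{2}\right)!\in\mathbb{F}_p$, so that $u_1$ and $-u_1$ are the square roots of $-1$ in $\mathbb{F}_p$. Let $G=\{a\in\mathbb{F}_{p^4}: a^{p^2}+a=0\}$, let $G_1,\dots,G_{p+1}$ be its $p+1$ subgroups of order $p$ (the additive subgroups generated by non-zero elements of $G$), and let $\phi_1:a\mapsto a^p$ on $\mathbb{F}_{p^4}$. Then among the $G_i$ there are exactly two subgroups stable under $\phi_1$, namely the set of solutions in $\mathbb{F}_{p^4}$ of $x^p=u_1x$ and the set of solutions of $x^p=-u_1x$. Moreover, if some $G_i$ is not stable under $\phi_1$, then its image $\phi_1(G_i)$ is another subgroup $G_j$, one has $\phi_1(G_j)=G_i$, and $\phi_1$ is a bijection from $G_i$ onto $G_j$. *)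

(* Defs.v *)
From HB Require Import structures.
From mathcomp Require Import all_boot all_order all_algebra all_fingroup.

Import GRing.Theory.
Local Open Scope ring_scope.

(* Meant for R = 'F_p and for R = F an extension field of 'F_p: the embedding
   of 'F_p in F sends u1 p 'F_p to u1 p F, since both are images of the same
   natural number. *)
Definition u1 (p : nat) (R : pzRingType) : R := (((p - 1) %/ 2)`!)%N%:R.

Definition G (p : nat) (F : finFieldType) : {set F} :=
  [set a | a ^+ (p ^ 2) + a == 0].

(* The finGroupType structure carried by a finFieldType is that of its additive
   group, so {group F} is the type of additive subgroups of F, and <[a]> is the
   additive subgroup generated by a. *)
Definition G_subgroups (p : nat) (F : finFieldType) : {set {group F}} :=
  [set H : {group F} | (H \subset G p F) && (#|H| == p)].

Definition phi1 (p : nat) (F : finFieldType) : F -> F := fun a => a ^+ p.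

Definition phi1_stable (p : nat) (F : finFieldType) (H : {set F}) : bool :=
  phi1 p F @: H \subset H.

Definition power_eq_solutions (p : nat) (F : finFieldType) (c : F) : {set F} :=
  [set x | x ^+ p == c * x].

Definition maps_bijectively (F : finFieldType) (f : F -> F) (A B : {set F}) :
    Prop :=
  {in A &, injective f} /\ f @: A = B.

(* Main.v *)
(* Every subgroup of order p of G is a line <[a]> over 'F_p, stable under phi1
   exactly when a ^+ p = k * a with k in 'F_p.  As phi1 squares to -1 on G,
   such a k satisfies k ^+ 2 = -1, so k = u1 or k = - u1, and the line is the
   kernel of x |-> x ^+ p - k * x.  All cardinalities come from counting kernels
   of additive maps x |-> x ^+ q + c * x: G itself is one, with q = p ^ 2. *)

Require Import Defs.
From HB Require Import structures.
From mathcomp Require Import all_boot all_order all_algebra all_fingroup.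
From mathcomp Require Import all_solvable all_field zify ring.

Import GRing.Theory FinRing.Theory.
Local Open Scope ring_scope.

(** * Wilson's theorem and the square roots of -1 *)

(** Wilson's theorem gives [(m + m)! = -1]. Modulo [m.*2.+1] the upper half of that factorial
    consists of the opposites of the factors of [m!], so it contributes [(-1) ^+ m * m!]. *)
Lemma pchar_half_fact_sqr (R : comNzRingType) (m : nat) :
  m.*2.+1 \in [pchar R] -> (m`!%:R : R) ^+ 2 = (-1) ^+ m.+1.
Proof.
move=> pR; have p_pr := pcharf_prime pR.
have factE n : n`! = (\prod_(i < n) i.+1)%N.
  by rewrite fact_prod big_add1 big_mkord.
have wilson : ((m + m)`!)%:R = -1 :> R.
  apply/eqP; rewrite -addr_eq0 natr1 -(dvdn_pcharf pR) addnn.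
  by have := Wilson (prime_gt1 p_pr); rewrite p_pr => <-.
have upper : (\prod_(i < m) (m + i).+1)%:R = (-1) ^+ m * m`!%:R :> R.
  rewrite factE !natr_prod -[in (-1) ^+ m](card_ord m) -prodrN.
  (* Reversing the order pairs factors whose sum is exactly [m.*2.+1], hence the quotient 1
     below. *)
  rewrite (reindex_inj rev_ord_inj); apply: eq_bigr => i _ /=.
  apply/eqP; rewrite -addr_eq0 -natrD -(dvdn_pcharf pR).
  by apply/dvdnP; exists 1%N; have := ltn_ord i; lia.
have: (-1) ^+ m * (m`!%:R : R) ^+ 2 = -1.
  rewrite -[RHS]wilson [in RHS]factE big_split_ord natrM -factE upper expr2.
  by rewrite mulrCA.
move/(congr1 ( *%R ((-1) ^+ m))).
by rewrite mulrA -expr2 sqrr_sign mul1r mulrN1 => ->; rewrite exprS mulN1r.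
Qed.

Lemma u1_sqr (p : nat) (R : comNzRingType) :
  (4 %| p - 1)%N -> p \in [pchar R] -> u1 p R ^+ 2 = -1.
Proof.
move=> p4 pR; have p_gt1 := prime_gt1 (pcharf_prime pR).
(* With [p = 4k + 1] the half [(p - 1) / 2 = 2k] is even, which fixes the sign as -1. *)
have [k pE] : exists k, p = (k.*2).*2.+1.
  by have /dvdnP[k Ek] := p4; exists k; lia.
rewrite /u1 (_ : (p - 1) %/ 2 = k.*2)%N; last by lia.
by rewrite pchar_half_fact_sqr -?pE // exprS -signr_odd odd_double mulr1.
Qed.

(** * Kernels of the additive maps [x ^+ q + c * x], for [q] a power of the characteristic *)

Section LinearizedBinomials.

Variables (F : finFieldType) (q : nat).
Hypothesis q_pchar : [pchar F].-nat q.

Let binom (c x : F) : F := x ^+ q + c * x.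

Lemma linearized_binomialM (c : F) :
  {in [set: F] &, {morph binom c : x y / (x * y)%g >-> (x * y)%g}}.
Proof.
move=> x y _ _; rewrite /binom !zmodMgE exprDn_pchar // mulrDr.
by rewrite addrACA.
Qed.

Canonical linearized_binomial_morphism c := Morphism (linearized_binomialM c).

Lemma in_ker_linearized_binomial c x :
  (x \in 'ker (linearized_binomial_morphism c))%g = (x ^+ q + c * x == 0).
Proof. by rewrite !inE. Qed.

(** The kernel consists of roots of ['X^q + c *: 'X], whose leading term is ['X^q] because
    [1 < q]. *)
Lemma card_ker_linearized_binomial c : (1 < q)%N ->
  (#|('ker (linearized_binomial_morphism c))%g| <= q)%N.
Proof.
move=> q_gt1; pose P := 'X^q + c *: 'X : {poly F}.
have sizeP : size P = q.+1.
  rewrite size_polyDl size_polyXn // ltnS (leq_trans (size_scale_leq _ _)) //.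
  by rewrite size_polyX.
rewrite -ltnS -sizeP cardE max_poly_roots ?enum_uniq //.
  by rewrite -size_poly_gt0 sizeP.
apply/allP=> x; rewrite mem_enum in_ker_linearized_binomial rootE.
by rewrite !hornerE.
Qed.

(* Since c ^+ q = c, the maps x ^+ q + c * x and x ^+ q - c * x compose to
   x ^+ (q * q) - c ^+ 2 * x, which vanishes on H; as each kernel has at most
   q elements and H has q * q of them, both kernels have exactly q. *)
Lemma card_linearized_binomial_roots (H : {group F}) (c : F) :
    (1 < q)%N -> c ^+ q = c -> #|H| = (q * q)%N ->
    {in H, forall x, x ^+ (q * q) = c ^+ 2 * x} ->
  #|[set x in H | x ^+ q + c * x == 0]| = q.
Proof.
move=> q_gt1 cq cardH HE; pose f := linearized_binomial_morphism.
have -> : [set x in H | x ^+ q + c * x == 0] = H :&: ('ker (f c))%g.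
  by apply/setP=> x; rewrite !inE.
apply/eqP; rewrite eqn_leq; apply/andP; split.
  apply: leq_trans (card_ker_linearized_binomial c q_gt1).
  by rewrite subset_leq_card ?subsetIr.
have imS : (f c @* H \subset 'ker (f (- c)))%g.
  apply/subsetP=> _ /morphimP[x _ Hx ->].
  rewrite in_ker_linearized_binomial /= /binom exprDn_pchar // -exprM HE //.
  rewrite exprMn cq.
  by apply/eqP; ring.
have := LagrangeI H ('ker (f c))%G.
rewrite -[X in #|X : _|%g](setIidPr (subsetT H)) -card_morphim cardH => HI.
have imq : (#|f c @* H|%g <= q)%N.
  apply: leq_trans (subset_leq_card imS) _.
  exact: card_ker_linearized_binomial.
by rewrite -(leq_pmul2r (ltnW q_gt1)) -HI leq_mul2l imq orbT.
Qed.

End LinearizedBinomials.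

Lemma pchar_abelem (F : finFieldType) (p : nat) (A : {group F}) :
  p \in [pchar F] -> p.-abelem%g A.
Proof.
move=> pF; apply/abelemP; first exact: pcharf_prime pF.
by split=> [|x _]; rewrite ?zmod_abelian // zmodXgE mulrn_pchar.
Qed.

(** * The group [G], its lines over the prime field, and the action of Frobenius on them *)

Section SubgroupsOfG.

Variables (p : nat) (F : finFieldType).
Hypotheses (p_prime : prime p) (card_F : #|F| = (p ^ 4)%N).

Let pF : p \in [pchar F]. Proof. exact: card_finPcharP card_F p_prime. Qed.
Let p_pchar : [pchar F].-nat p. Proof. by rewrite pnatE. Qed.
Let p_gt1 : (1 < p)%N. Proof. exact: prime_gt1. Qed.
Let p2_pchar : [pchar F].-nat (p ^ 2)%N. Proof. by rewrite pnatX p_pchar. Qed.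

Lemma in_G a : (a \in G p F) = (a ^+ (p ^ 2) == - a).
Proof. by rewrite inE addr_eq0. Qed.

Lemma group_set_G : group_set (G p F).
Proof.
suff -> : G p F = ('ker (linearized_binomial_morphism F _ p2_pchar 1%R))%g.
  exact: groupP.
by apply/setP=> x; rewrite in_ker_linearized_binomial inE mul1r.
Qed.
Canonical G_group := Group group_set_G.

Lemma group_set_power_eq_solutions c : group_set (power_eq_solutions p F c).
Proof.
suff -> : power_eq_solutions p F c =
    ('ker (linearized_binomial_morphism F _ p_pchar (- c)%R))%g.
  exact: groupP.
by apply/setP=> x; rewrite in_ker_linearized_binomial inE mulNr subr_eq0.
Qed.
Canonical power_eq_solutions_group c :=
  Group (group_set_power_eq_solutions c).

(** The kernel count with exponent [p ^ 2], [c = 1] and the whole field as [H], where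
    [x ^+ (p ^ 4) = x]. *)
Lemma card_G : #|G p F| = (p ^ 2)%N.
Proof.
have := @card_linearized_binomial_roots F (p ^ 2) p2_pchar [group of setT] 1.
rewrite expr1n cardsT card_F -expnD => H; rewrite -[RHS]H //.
- by apply: eq_card => x; rewrite !inE mul1r.
- by rewrite -(exp1n 2) ltn_exp2r.
- by move=> x _; rewrite expr1n mul1r -card_F expf_card.
Qed.

Lemma card_power_eq_solutions c : c ^+ 2 = -1 -> c ^+ p = c ->
  #|power_eq_solutions p F c| = p.
Proof.
move=> c2 cp.
have := @card_linearized_binomial_roots F p p_pchar G_group (- c) p_gt1.
rewrite exprNn_pchar // cp sqrrN c2 card_G mulnn => H; rewrite -[RHS]H //.
(* Membership in [G] is automatic: [x ^+ p = c * x] gives [x ^+ (p ^ 2) = c ^+ 2 * x = - x]. *)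
- apply: eq_card => x; rewrite !inE mulNr subr_eq0 andb_idl // => /eqP xp.
  by rewrite -mulnn exprM xp exprMn cp xp mulrA -expr2 c2 mulN1r addNr.
- by move=> x; rewrite /= in_G mulN1r => /eqP.
Qed.

Lemma power_eq_solutions_subG c : c ^+ 2 = -1 -> c ^+ p = c ->
  power_eq_solutions p F c \subset G p F.
Proof.
move=> c2 cp; apply/subsetP=> x; rewrite inE in_G => /eqP xp.
by rewrite -mulnn exprM xp exprMn cp xp mulrA -expr2 c2 mulN1r.
Qed.

Lemma in_G_subgroups (H : {group F}) :
  (H \in G_subgroups p F) = (H \subset G p F) && (#|H| == p).
Proof. by rewrite inE. Qed.

(** [G] is elementary abelian of rank 2, and such a group has [p + 1] subgroups of order [p]. *)
Lemma card_G_subgroups : #|G_subgroups p F| = p.+1.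
Proof.
have GE : G_group \in ('E_p^2([set: F]))%g.
  by apply/pnElemP; rewrite subsetT pchar_abelem // card_G pfactorK.
rewrite -(card_p1Elem_p2Elem GE) p1ElemE //.
by apply: eq_card => H; rewrite !inE.
Qed.

Lemma G_subgroupsP (H : {group F}) :
  reflect (exists a, [/\ a \in G p F, a != 0 & H = <[a]>%G])
          (H \in G_subgroups p F).
Proof.
rewrite in_G_subgroups; apply: (iffP andP) => [[HG /eqP cH]|[a [Ga a0 ->]]].
  have /cyclicP[a Ha] : cyclic H by rewrite prime_cyclic // cH.
  have aH : a \in H by rewrite Ha cycle_id.
  exists a; split; [exact: subsetP HG a aH | | exact/val_inj].
  apply: contra_eq_neq cH => a0; rewrite Ha a0 (cycle1 F) cards1.
  by rewrite neq_ltn p_gt1.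
rewrite cycle_subG Ga -orderE.
by rewrite (abelem_order_p (pchar_abelem F p G_group pF)).
Qed.

(** This relation yields both the equation [k ^+ 2 = -1] on a stable line and the involution that
    [phi1] induces on subgroups. *)
Lemma phi1K_G : {in G p F, forall a, phi1 p F (phi1 p F a) = - a}.
Proof. by move=> a; rewrite in_G => /eqP <-; rewrite /phi1 -exprM mulnn. Qed.

Lemma phi1_inj : injective (phi1 p F).
Proof. exact: fmorph_inj (pFrobenius_aut pF). Qed.

(** The morphism structure makes the image of a subgroup a [{group F}] again. *)
Lemma phi1M : {in [set: F] &, {morph phi1 p F : x y / (x * y)%g}}.
Proof. by move=> x y _ _; rewrite /phi1 !zmodMgE exprDn_pchar. Qed.
Canonical phi1_morphism := Morphism phi1M.

Lemma phi1_G : {in G p F, forall a, phi1 p F a \in G p F}.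
Proof.
move=> a; rewrite !in_G /phi1 => /eqP Ga.
by rewrite exprAC Ga exprNn_pchar.
Qed.

Lemma phi1_imset_G_subgroups (H : {group F}) : H \in G_subgroups p F ->
  (phi1_morphism @* H)%G \in G_subgroups p F.
Proof.
rewrite !in_G_subgroups /= morphimEsub ?subsetT // => /andP[HG /eqP cH].
rewrite card_imset ?cH ?eqxx ?andbT //; last exact: phi1_inj.
by apply/subsetP=> _ /imsetP[a Ha ->]; apply: phi1_G (subsetP HG a Ha).
Qed.

(** Applying [phi1] twice negates, and a subgroup is closed under opposites; injectivity turns the
    inclusion into an equality. *)
Lemma phi1_imsetK (H : {group F}) : H \subset G p F ->
  phi1 p F @: (phi1 p F @: H) = H.
Proof.
move=> HG; apply/eqP; rewrite eqEcard !(card_imset _ phi1_inj) leqnn andbT.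
apply/subsetP=> _ /imsetP[_ /imsetP[a Ha ->] ->].
by rewrite phi1K_G ?(subsetP HG) // -zmodVgE groupV.
Qed.

Lemma phi1_stable_G_subgroupsE (H : {group F}) (c : F) :
    c ^+ 2 = -1 -> c ^+ p = c -> H \in G_subgroups p F ->
  phi1_stable p F H = (H == power_eq_solutions_group c)
                      || (H == power_eq_solutions_group (- c)).
Proof.
move=> c2 cp GH; apply/idP/orP => [/subsetP stH | ].
  have /G_subgroupsP[a [Ga a0 HE]] := GH.
  have aH : a \in H by rewrite HE cycle_id.
  have /cycleP[k ak] : phi1 p F a \in <[a]>%g.
    by have := stH _ (imset_f _ aH); rewrite [X in _ \in gval X]HE.
  (* The generator solves [x ^+ p = d * x], so the line lies in the solution group, and both have
     [p] elements. *)
  have solH d : d ^+ 2 = -1 -> d ^+ p = d -> phi1 p F a = d * a ->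
      H == power_eq_solutions_group d.
    move=> d2 dp ad; rewrite -val_eqE /= eqEcard card_power_eq_solutions //.
    move: GH; rewrite in_G_subgroups => /andP[_ /eqP->].
    by rewrite leqnn andbT HE cycle_subG inE; apply/eqP.
  rewrite zmodXgE -mulr_natl in ak.
  (* Frobenius fixes [k%:R], so applying [phi1] to [phi1 a = k * a] gives [- a = k ^+ 2 * a], where
     [a] cancels. *)
  have : (k%:R : F) ^+ 2 == c ^+ 2.
    rewrite c2 -(inj_eq (mulIf a0)) mulN1r -(phi1K_G _ Ga) ak /phi1 exprMn.
    by rewrite -/(phi1 p F a) ak -(pFrobenius_autE pF) pFrobenius_aut_nat mulrA.
  rewrite eqf_sqr => /orP[]/eqP kc; rewrite kc in ak.
    by left; apply: solH.
  by right; apply: solH; rewrite ?sqrrN ?exprNn_pchar ?cp.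
have stable d : d ^+ p = d -> phi1_stable p F (power_eq_solutions p F d).
  move=> dp; apply/subsetP=> _ /imsetP[x xP ->].
  by move: xP; rewrite !inE /phi1 => /eqP xp; rewrite xp exprMn dp xp.
by case=> /eqP->; apply: stable; rewrite ?exprNn_pchar ?cp.
Qed.

(** A common non-zero solution [a] satisfies [c * a = a ^+ p = d * a]. *)
Lemma power_eq_solutions_group_inj (c d : F) : c ^+ 2 = -1 -> c ^+ p = c ->
  power_eq_solutions_group c = power_eq_solutions_group d -> c = d.
Proof.
move=> c2 cp cdE.
have /G_subgroupsP[a [_ a0 aE]] :
    power_eq_solutions_group c \in G_subgroups p F.
  rewrite in_G_subgroups power_eq_solutions_subG //=.
  by rewrite card_power_eq_solutions.
have ac : a \in power_eq_solutions_group c by rewrite aE cycle_id.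
have ad := ac; rewrite cdE in ad.
move: ac ad; rewrite !inE => /eqP -> /eqP.
exact: mulIf.
Qed.

End SubgroupsOfG.

(** Here [p] is odd and [u1] is non-zero, so [2 * u1] does not vanish. This keeps the two stable
    subgroups distinct. *)
Lemma u1_neqN (p : nat) (F : fieldType) :
  (4 %| p - 1)%N -> p \in [pchar F] -> u1 p F != - u1 p F.
Proof.
move=> p4 pF; have p_gt1 := prime_gt1 (pcharf_prime pF).
rewrite -addr_eq0 -mulr2n -mulr_natl mulf_eq0 negb_or -(dvdn_pcharf pF).
rewrite -[u1 p F == 0]sqrf_eq0 u1_sqr // oppr_eq0 oner_eq0 andbT.
by apply/negP => /dvdn_leq; lia.
Qed.

Theorem theorem4p7 (p : nat) (F : finFieldType)
    (p_prime : prime p) (p1_dvd4 : (4 %| p - 1)%N)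
    (card_F : #|F| = (p ^ 4)%N) :
  [/\ forall x : 'F_p, x ^+ 2 = -1 <-> (x = u1 p 'F_p \/ x = - u1 p 'F_p),
      #|G_subgroups p F| = p.+1 /\
      (forall H : {group F}, H \in G_subgroups p F <->
         exists a : F, [/\ a \in G p F, a != 0 & H = <[a]>%G]),
      #|[set H in G_subgroups p F | phi1_stable p F H]| = 2%N /\
      [set gval H | H in G_subgroups p F & phi1_stable p F H] =
        [set power_eq_solutions p F (u1 p F);
             power_eq_solutions p F (- u1 p F)]
    & forall H : {group F}, H \in G_subgroups p F -> ~~ phi1_stable p F H ->
        exists K : {group F},
          [/\ K \in G_subgroups p F, K != H,
              phi1 p F @: H = K :> {set F},
              phi1 p F @: K = H :> {set F}
            & maps_bijectively F (phi1 p F) H K]].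
Proof.
have pF : p \in [pchar F] := card_finPcharP card_F p_prime.
have u2 : u1 p F ^+ 2 = -1 by exact: u1_sqr.
(* [u1] is the image of a natural number, hence fixed by Frobenius. *)
have up : u1 p F ^+ p = u1 p F.
  by rewrite -(pFrobenius_autE pF) pFrobenius_aut_nat.
have Nu2 : (- u1 p F) ^+ 2 = -1 by rewrite sqrrN.
have Nup : (- u1 p F) ^+ p = - u1 p F by rewrite exprNn_pchar ?up // pnatE.
pose P := power_eq_solutions_group p F p_prime card_F.
have PG c : c ^+ 2 = -1 -> c ^+ p = c -> P c \in G_subgroups p F.
  move=> c2 cp; rewrite in_G_subgroups power_eq_solutions_subG //=.
  by rewrite card_power_eq_solutions.
have stableE : [set H in G_subgroups p F | phi1_stable p F H] =
    [set P (u1 p F); P (- u1 p F)].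
  apply/setP=> H; rewrite !inE -in_G_subgroups.
  apply/andP/orP => [[GH]|PH].
    by rewrite (phi1_stable_G_subgroupsE p F p_prime card_F H (u1 p F)) // => /orP.
  have GH : H \in G_subgroups p F by case: PH => /eqP->; apply: PG.
  rewrite GH (phi1_stable_G_subgroupsE p F p_prime card_F H (u1 p F)) //.
  by split=> //; apply/orP.
split.
- move=> x; have uFp : u1 p 'F_p ^+ 2 = -1 by apply: u1_sqr; rewrite ?pchar_Fp.
  split=> [/eqP|[]->]; rewrite ?sqrrN //.
  by rewrite -uFp eqf_sqr => /orP[]/eqP ->; [left | right].
- split; first exact: card_G_subgroups.
  by move=> H; split=> [/G_subgroupsP|/G_subgroupsP]; apply.
- split.
    rewrite stableE cards2; case: eqVneq => // /power_eq_solutions_group_inj.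
    by move/(_ u2 up)/eqP; rewrite (negPf (u1_neqN p F p1_dvd4 pF)).
  (* The stable subgroups are passed from groups to underlying sets as an image under [gval], so
     that [stableE] applies. *)
  have -> : [set gval H | H in G_subgroups p F & phi1_stable p F H] =
      @gval _ @: [set H in G_subgroups p F | phi1_stable p F H].
    by apply: eq_imset.
  by rewrite stableE imsetU1 imset_set1.
- move=> H GH unst.
  have /andP[HG _] : (H \subset G p F) && (#|H| == p) by rewrite -in_G_subgroups.
  have phiHE : (phi1_morphism p F p_prime card_F @* H)%g = phi1 p F @: H.
    by rewrite morphimEsub ?subsetT.
  exists (phi1_morphism p F p_prime card_F @* H)%G; rewrite /= phiHE.
  split=> //; first exact: phi1_imset_G_subgroups.
  (* If the image were [H] itself, [H] would be stable. *)
  + apply: contraNneq unst => KH; rewrite /phi1_stable -phiHE.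
    by rewrite -[X in _ \subset gval X]KH.
  + exact: (phi1_imsetK p F p_prime card_F).
  + by split=> //; move=> x y _ _; apply: (phi1_inj p F p_prime card_F).
Qed.
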